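(* Let $U$ be either the square $I^2$ or the triangle $\Delta^2$, let $p\ge 1$ be an integer, and let $F:U\to\mathbb{R}^2$ be a polynomial function of degree at most $p$ (degree at most $p$ in each individual coordinate if $U=I^2$, total degree at most $p$ if $U=\Delta^2$). Let $G_\xi$ and $G_\eta$ be the lists of Bernstein-Bézier control points of $\partial F/\partial\xi$ and $\partial F/\partial\eta$. Then the following are equivalent: (1) the matrix $[\mathbf{u},\mathbf{v}]$ with columns $\mathbf{u},\mathbf{v}$ is invertible for every $\mathbf{u}\in\operatorname{hull}(G_\xi)$ and every $\mathbf{v}\in\operatorname{hull}(G_\eta)$; (2) both of the following hold: there exists a vector $\mathbf{h}\in\mathbb{R}^2$ such that $\mathbf{h}^T\mathbf{f}>0$ for all $\mathbf{f}\in G_\xi\cup G_\eta$; and there exists a vector $\bar{\mathbf{h}}\in\mathbb{R}^2$ such that $\bar{\mathbf{h}}^T\mathbf{f}>0$ for all $\mathbf{f}\in G_\xi$ and $\bar{\mathbf{h}}^T\mathbf{f}<0$ for all $\mathbf{f}\in G_\eta$.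
   Context: $\operatorname{hull}$ denotes convex hull. $I^2=[0,1]^2$; $\Delta^2=\{(\xi,\eta):\xi,\eta\ge 0,\ \xi+\eta\le 1\}$. Bernstein-Bézier (BB) form: $F$ is written uniquely with control points $\mathbf{f}_{i,j}\in\mathbb{R}^2$ as follows. On $I^2$: $F(\xi,\eta)=\sum_{i=0}^p\sum_{j=0}^p \mathbf{f}_{i,j}\binom{p}{i}\binom{p}{j}(1-\xi)^{p-i}\xi^i(1-\eta)^{p-j}\eta^j$. On $\Delta^2$: $F(\xi,\eta)=\sum_{i,j\ge 0,\,i+j\le p}\mathbf{f}_{i,j}\frac{p!}{i!\,j!\,(p-i-j)!}\xi^i\eta^j(1-\xi-\eta)^{p-i-j}$. $G_\xi$ is the finite list of all vectors $p(\mathbf{f}_{i+1,j}-\mathbf{f}_{i,j})$, over all indices for which both control points are defined; $G_\eta$ is the finite list of all vectors $p(\mathbf{f}_{i,j+1}-\mathbf{f}_{i,j})$, over all indices for which both control points are defined. These are the BB control points of $\partial F/\partial\xi$ and $\partial F/\partial\eta$ respectively. *)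

(* Defs.v *)
From HB Require Import structures.
From mathcomp Require Import all_boot all_order all_algebra.
From mathcomp Require Import boolp classical_sets reals convex.
From mathcomp Require Import mpoly.
From mathcomp Require Import ring zify.

Set Implicit Arguments.
Unset Strict Implicit.
Unset Printing Implicit Defensive.

Import Order.TTheory GRing.Theory Num.Theory.

Local Open Scope classical_set_scope.
Local Open Scope ring_scope.

Inductive dom_shape := Square | Triangle.

Definition dom_set (R : realType) (U : dom_shape) : set 'cV[R]_2 :=
  match U with
  | Square => [set x : 'cV[R]_2 | 0 <= x 0 0 <= 1 /\ 0 <= x 1 0 <= 1]
  | Triangle =>
      [set x : 'cV[R]_2 | 0 <= x 0 0 /\ 0 <= x 1 0 /\ x 0 0 + x 1 0 <= 1]
  end.

Definition degree_le (R : realType) (U : dom_shape) (p : nat)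
    (P : {mpoly R[2]}) : Prop :=
  match U with
  | Square => forall m, m \in msupp P -> forall k : 'I_2, (m k <= p)%N
  | Triangle => (msize P <= p.+1)%N (* msize is the total degree plus one *)
  end.

(* A map from U to R^2 is a total function whose values outside U are
   irrelevant. *)
Definition polynomial_on (R : realType) (U : dom_shape) (p : nat)
    (F : 'cV[R]_2 -> 'cV[R]_2) : Prop :=
  exists P : 'I_2 -> {mpoly R[2]},
    (forall k, degree_le U p (P k)) /\
    forall x, dom_set U x -> forall k, F x k 0 = (P k).@[fun l => x l 0].

Definition bb_index (U : dom_shape) (p i j : nat) : bool :=
  match U with
  | Square => (i <= p)%N && (j <= p)%N
  | Triangle => (i + j <= p)%N
  end.

Definition bb_basis (R : realType) (U : dom_shape) (p i j : nat)
    (x : 'cV[R]_2) : R :=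
  let xi := x 0 0 in
  let eta := x 1 0 in
  match U with
  | Square =>
      'C(p, i)%:R * 'C(p, j)%:R * (1 - xi) ^+ (p - i) * xi ^+ i *
      (1 - eta) ^+ (p - j) * eta ^+ j
  | Triangle =>
      (p`!)%:R / ((i`!)%:R * (j`!)%:R * ((p - i - j)`!)%:R) *
      xi ^+ i * eta ^+ j * (1 - xi - eta) ^+ (p - i - j)
  end.

(* Only the values of f at the pairs (i, j) with bb_index U p i j count as
   control points. *)
Definition bb_form (R : realType) (U : dom_shape) (p : nat)
    (F : 'cV[R]_2 -> 'cV[R]_2) (f : nat -> nat -> 'cV[R]_2) : Prop :=
  forall x, dom_set U x ->
    F x = \sum_(0 <= i < p.+1) \sum_(0 <= j < p.+1 | bb_index U p i j)
            bb_basis U p i j x *: f i j.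

Definition bb_pairs (U : dom_shape) (p : nat) : seq (nat * nat) :=
  [seq ij <- [seq (i, j) | i <- iota 0 p.+1, j <- iota 0 p.+1]
     | bb_index U p ij.1 ij.2].

Definition G_xi (R : realType) (U : dom_shape) (p : nat)
    (f : nat -> nat -> 'cV[R]_2) : seq 'cV[R]_2 :=
  [seq p%:R *: (f ij.1.+1 ij.2 - f ij.1 ij.2)
     | ij <- bb_pairs U p & bb_index U p ij.1.+1 ij.2].

Definition G_eta (R : realType) (U : dom_shape) (p : nat)
    (f : nat -> nat -> 'cV[R]_2) : seq 'cV[R]_2 :=
  [seq p%:R *: (f ij.1 ij.2.+1 - f ij.1 ij.2)
     | ij <- bb_pairs U p & bb_index U p ij.1 ij.2.+1].

Definition hull (R : realType) (G : seq 'cV[R]_2) : set 'cV[R]_2 :=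
  smallest (@convex_set R 'cV[R]_2) [set` G].

(* Every polynomial map of the allowed degree has a Bernstein-Bezier form, so
   quantifying over the f with bb_form U p F f is never vacuous. *)
Section BBFormExists.
Variables (R : realType) (U : dom_shape) (p : nat).

Let bbsum (c : nat -> nat -> R) (x : 'cV[R]_2) : R :=
  \sum_(0 <= i < p.+1) \sum_(0 <= j < p.+1 | bb_index U p i j)
    bb_basis U p i j x * c i j.

Let rep (g : 'cV[R]_2 -> R) := exists c, g =1 bbsum c.

Let rep_eq g h : g =1 h -> rep h -> rep g.
Proof. by move=> gh [c hc]; exists c => x; rewrite gh. Qed.

Let rep_sum (I : eqType) (s : seq I) (g : I -> 'cV[R]_2 -> R) :
  (forall i, i \in s -> rep (g i)) -> rep (fun x => \sum_(i <- s) g i x).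
Proof.
elim: s => [_|i s IHs rg].
  exists (fun _ _ => 0) => x; rewrite big_nil /bbsum big1// => k _.
  by rewrite big1// => l _; rewrite mulr0.
have [c gc] := rg i (mem_head _ _).
have [|d sd] := IHs; first by move=> k ks; apply: rg; rewrite inE ks orbT.
exists (fun k l => c k l + d k l) => x.
rewrite big_cons gc sd /bbsum -big_split/=; apply: eq_bigr => k _.
by rewrite -big_split/=; apply: eq_bigr => l _; rewrite mulrDr.
Qed.

Let rep_scale a g : rep g -> rep (fun x => a * g x).
Proof.
move=> [c gc]; exists (fun k l => a * c k l) => x.
rewrite gc /bbsum mulr_sumr; apply: eq_bigr => k _.
by rewrite mulr_sumr; apply: eq_bigr => l _; rewrite mulrCA.
Qed.

#[local] Arguments bb_index : simpl never.
#[local] Arguments bb_basis : simpl never.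
Let rep_basis i j : (i <= p)%N -> (j <= p)%N -> bb_index U p i j ->
  rep (bb_basis U p i j).
Proof.
move=> ip jp ij; exists (fun k l => ((k == i) && (l == j))%:R) => x.
have ui : uniq (index_iota 0 p.+1) := iota_uniq _ _.
have mi : i \in index_iota 0 p.+1 by rewrite mem_index_iota.
have mj : j \in index_iota 0 p.+1 by rewrite mem_index_iota.
rewrite /bbsum (bigD1_seq i mi ui)/= [X in _ + X]big1 ?addr0; last first.
  by move=> k /negPf ki; rewrite big1// => l _; rewrite ki mulr0.
rewrite big_mkcond (bigD1_seq j mj ui)/= ij !eqxx mulr1 big1 ?addr0// => l.
by move=> /negPf lj; rewrite lj andbF mulr0; case: ifP.
Qed.

Let rep_monomial a b :
  match U with Square => (a <= p)%N && (b <= p)%N | Triangle => (a + b <= p)%N end ->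
  rep (fun x => x 0 0 ^+ a * x 1 0 ^+ b).
Proof.
have [UE|UE] : U = Square \/ U = Triangle by case: U; [left|right].
  rewrite UE.
  move=> /andP[ap bp].
  pose t (kl : nat * nat) (x : 'cV[R]_2) :=
    ('C(p - a, kl.1)%:R * 'C(p - b, kl.2)%:R /
     ('C(p, a + kl.1)%:R * 'C(p, b + kl.2)%:R)) *
    bb_basis U p (a + kl.1) (b + kl.2) x.
  suff H (x : 'cV[R]_2) : x 0 0 ^+ a * x 1 0 ^+ b =
     \sum_(kl <- [seq (k, l) | k <- iota 0 (p - a).+1, l <- iota 0 (p - b).+1])
       t kl x.
    apply: (rep_eq H); apply: rep_sum => -[k l] /allpairsPdep[k' [l' []]]; rewrite !mem_iota !add0n => /andP[_ ka] /andP[_ lb] [-> ->].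
    by apply: rep_scale; apply: rep_basis; rewrite /= ?/bb_index ?UE; lia.
  have E n (y : R) : 1 = \sum_(k <- iota 0 n.+1) (1 - y) ^+ (n - k) * y ^+ k *+ 'C(n, k).
    by rewrite -[LHS](expr1n _ n) -{1}(subrK y 1) exprDn -(big_mkord xpredT (fun k => (1 - y) ^+ (n - k) * y ^+ k *+ 'C(n, k))) /index_iota subn0.
  rewrite -[LHS]mulr1 [X in _ * X](E (p - b)%N (x 1 0)).
  rewrite -[X in X * _]mulr1 [X in _ * X * _](E (p - a)%N (x 0 0)).
  rewrite big_allpairs [X in X * _]mulr_sumr mulr_suml big_seq [RHS]big_seq; apply: eq_bigr => k.
  rewrite mem_iota add0n ltnS => ka.
  rewrite mulr_sumr big_seq [RHS]big_seq; apply: eq_bigr => l.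
  rewrite mem_iota add0n ltnS => lb.
  have c1 : ('C(p, a + k)%:R : R) != 0.
    by rewrite pnatr_eq0 -lt0n bin_gt0 -(subnKC ap) leq_add2l.
  have c2 : ('C(p, b + l)%:R : R) != 0.
    by rewrite pnatr_eq0 -lt0n bin_gt0 -(subnKC bp) leq_add2l.
  rewrite /t /bb_basis UE /= !subnDA !exprD.
  rewrite -[_ *+ 'C(p - a, k)]mulr_natr -[_ *+ 'C(p - b, l)]mulr_natr.
  move: ('C(p, a + k)%:R : R) ('C(p, b + l)%:R : R) c1 c2 => A B c1 c2.
  move: ('C(p - a, k)%:R : R) ('C(p - b, l)%:R : R) => C D.
  move: (x 0 0 ^+ a) (x 0 0 ^+ k) (x 1 0 ^+ b) (x 1 0 ^+ l) => e1 e2 e3 e4.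
  move: ((1 - x 0 0) ^+ _) ((1 - x 1 0) ^+ _) => e5 e6.
  by field; rewrite c1 c2.
rewrite UE => abp.
set n := (p - (a + b))%N.
pose s := [seq (k, l) | k <- iota 0 n.+1, l <- iota 0 k.+1].
pose t (kl : nat * nat) (x : 'cV[R]_2) :=
  let i := (a + (n - kl.1))%N in let j := (b + kl.2)%N in
  ('C(n, kl.1)%:R * 'C(kl.1, kl.2)%:R /
    ((p`!)%:R / ((i`!)%:R * (j`!)%:R * ((p - i - j)`!)%:R))) *
  bb_basis U p i j x.
suff H (x : 'cV[R]_2) : x 0 0 ^+ a * x 1 0 ^+ b = \sum_(kl <- s) t kl x.
  apply: (rep_eq H); apply: rep_sum => -[k l] /allpairsPdep[k' [l' []]]; rewrite !mem_iota !add0n => /andP[_ ka] /andP[_ lb] [-> ->].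
  apply: rep_scale; apply: rep_basis; rewrite /= ?/bb_index ?UE; rewrite /n in ka *; lia.
pose xi := x 0 0; pose eta := x 1 0; rewrite -/xi -/eta.
have E : 1 = \sum_(k <- iota 0 n.+1) \sum_(l <- iota 0 k.+1)
   xi ^+ (n - k) * ((1 - xi - eta) ^+ (k - l) * eta ^+ l *+ 'C(k, l)) *+ 'C(n, k).
  rewrite -[LHS](expr1n _ n) -{1}(subrKC xi 1) -{1}(subrK eta (1 - xi)).
  rewrite exprDn -(big_mkord xpredT (fun k => xi ^+ (n - k) * (1 - xi - eta + eta) ^+ k *+ 'C(n, k))) /index_iota subn0.
  apply: eq_bigr => k _.
  rewrite exprDn -(big_mkord xpredT (fun l => (1 - xi - eta) ^+ (k - l) * eta ^+ l *+ 'C(k, l))) /index_iota subn0.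
  by rewrite mulr_sumr -sumrMnl.
rewrite -[LHS]mulr1 [X in _ * X]E big_allpairs_dep mulr_sumr big_seq [RHS]big_seq; apply: eq_bigr => k.
rewrite mem_iota add0n ltnS => kn.
rewrite mulr_sumr big_seq [RHS]big_seq; apply: eq_bigr => l.
rewrite mem_iota add0n ltnS => lk.
have fn0 m : ((m`!)%:R : R) != 0 by rewrite pnatr_eq0 -lt0n fact_gt0.
rewrite /t /bb_basis UE /= -/xi -/eta.
have -> : (p - (a + (n - k)) - (b + l) = k - l)%N by rewrite /n in kn *; lia.
rewrite !exprD -[_ *+ 'C(k, l)]mulr_natr -[_ *+ 'C(n, k)]mulr_natr; field.
by rewrite !fn0.
Qed.

Lemma bb_form_exists F : polynomial_on U p F -> exists f, bb_form (R := R) U p F f.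
Proof.
move=> [P [dP FP]].
have H k : rep (fun x => (P k).@[fun l => x l 0]).
  apply: (@rep_eq _ (fun x => \sum_(m <- msupp (P k))
            (P k)@_m * (x 0 0 ^+ m 0 * x 1 0 ^+ m 1))).
    move=> x; rewrite mevalE; apply: eq_bigr => m _; congr (_ * _).
    by rewrite big_ord_recl big_ord1; congr (_ * x _ _ ^+ m _); apply: val_inj.
  apply: rep_sum => m mP; apply: rep_scale; apply: rep_monomial.
  move: dP; rewrite /degree_le; case: U => /(_ k) dk.
    by rewrite !dk.
  have := leq_trans (msize_mdeg_lt mP) dk.
  by rewrite ltnS mdegE big_ord_recl big_ord1; congr ((_ + m _)%N <= _)%N; apply: val_inj.
have [c0 h0] := H 0; have [c1 h1] := H 1.
exists (fun i j => \col_k if k == 0 then c0 i j else c1 i j) => x Ux.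
apply/colP => k; rewrite FP// summxE.
have -> : (P k).@[fun l => x l 0] = bbsum (if k == 0 then c0 else c1) x.
  case: (eqVneq k 0) => [->//|k0]; have -> : k = 1; last by [].
  by apply: val_inj; case: k k0 => [[|[|]]].
apply: eq_bigr => i _; rewrite summxE; apply: eq_bigr => j _.
by rewrite !mxE; case: ifP.
Qed.
End BBFormExists.

(* Main.v *)
Require Import Defs.
From mathcomp Require Import all_boot all_order all_algebra.
From mathcomp Require Import boolp classical_sets reals convex.
From mathcomp Require Import mpoly.
From mathcomp Require Import interval_inference ring lra.

Set Implicit Arguments.
Unset Strict Implicit.
Unset Printing Implicit Defensive.

Import Order.TTheory GRing.Theory Num.Theory.

Local Open Scope ring_scope.

(* Writing x /\ y for the determinant of [x, y], the first condition says
   exactly that a /\ b is nonzero with the same sign for all a in G_xi and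
   b in G_eta: otherwise it would vanish somewhere along a segment of
   hull G_xi or hull G_eta. If a1 and b1 are the elements of G_xi and G_eta
   that are extreme in the angular order on the facing sides, then the line
   through 0 and a1 + b1 strictly separates G_xi from G_eta, which gives
   hbar; the same argument for G_xi and - G_eta gives h. Conversely
     (h . u) (hbar . v) - (h . v) (hbar . u) = (h /\ hbar) (u /\ v)
   and the left-hand side is negative for u and v in the hulls. *)

Lemma scalarZ (R : pzRingType) (V : lmodType R) (L : V -> R) :
  scalar L -> forall c x, L (c *: x) = c * L x.
Proof.
move=> linL c x; have L0 : L 0 = 0.
  by have := linL (-1) x x; rewrite scaleN1r addNr mulN1r addNr.
by have := linL c x 0; rewrite !addr0 L0 addr0.
Qed.

Section Hull.
Variables (R : realType) (G : seq 'cV[R]_2).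
Implicit Types (x y : 'cV[R]_2) (L : 'cV[R]_2 -> R).

Lemma hull_mem x : x \in G -> hull G x.
Proof. by move=> Gx A [_ GA]; apply: GA. Qed.

Lemma hull_conv (t : R) x y :
  0 <= t <= 1 -> hull G x -> hull G y -> hull G (t *: x + (1 - t) *: y).
Proof.
move=> t01 Gx Gy A [cA GA].
by have /set_mem := cA _ _ (Itv01 (proj1 (andP t01)) (proj2 (andP t01)))
  (mem_set (Gx A (conj cA GA))) (mem_set (Gy A (conj cA GA))).
Qed.

(** The open half-plane where [L] is positive is convex and contains [G], hence contains the
    smallest such set. *)
Lemma hull_gt0 L x : scalar L ->
  (forall g, g \in G -> 0 < L g) -> hull G x -> 0 < L x.
Proof.
move=> linL LG; apply: (@smallest_sub _ _ _ [set z | 0 < L z]%classic) => //.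
move=> y z t /set_mem /= Ly /set_mem /= Lz; apply/mem_set => /=.
rewrite linL (scalarZ linL); exact: (@convR_gt0 _ (L y) (L z) t).
Qed.

Lemma hull_same_sign L : scalar L -> (forall z, hull G z -> L z != 0) ->
  forall x y, hull G x -> hull G y -> 0 < L x * L y.
Proof.
move=> linL Ln0 x y Gx Gy; rewrite ltNge; apply/negP => Lxy.
have [Lx Ly] := (Ln0 x Gx, Ln0 y Gy).
have D0 : L y - L x != 0.
  by apply: contra_neq Lx => D; nra.
(* The zero of the affine function [t * L x + (1 - t) * L y]; it lies in [0, 1] because [L x] and
   [L y] have opposite signs. *)
pose t := L y / (L y - L x).
have DE : t * (L y - L x) = L y by rewrite /t mulfVK.
have t01 : 0 <= t <= 1.
  have D2 : 0 < (L y - L x) ^+ 2 by rewrite lt0r sqr_ge0 sqrf_eq0 D0.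
  have tE : t * (L y - L x) ^+ 2 = L y * (L y - L x) by rewrite expr2 mulrA DE.
  apply/andP; split.
    by rewrite -(pmulr_lge0 _ D2) tE; nra.
  by rewrite -(ler_pM2r D2) tE mul1r; nra.
have /negP[] := Ln0 _ (hull_conv t01 Gx Gy).
by rewrite linL (scalarZ linL); apply/eqP; lra.
Qed.

End Hull.

Section Plane.
Variable R : realType.
Implicit Types (u v w x y h : 'cV[R]_2) (A B : seq 'cV[R]_2).

Definition dot h x : R := (h^T *m x) 0 0.

Definition wedge u v : R := u 0 0 * v 1 0 - u 1 0 * v 0 0.

Definition rot x : 'cV[R]_2 := \col_k if k == 0 then x 1 0 else - x 0 0.

Lemma dotE h x : dot h x = h 0 0 * x 0 0 + h 1 0 * x 1 0.
Proof.
rewrite /dot mxE big_ord_recl big_ord1 !mxE.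
by congr (_ + h _ _ * x _ _); apply: val_inj.
Qed.

Lemma dot_scalar h : scalar (dot h).
Proof. by move=> c x y; rewrite !dotE !mxE; ring. Qed.

Lemma dot_rot w x : dot (rot w) x = wedge x w.
Proof. by rewrite dotE !mxE /= /wedge; ring. Qed.

Lemma wedge_scalarl v : scalar (wedge^~ v).
Proof. by move=> c x y; rewrite /wedge !mxE; ring. Qed.

Lemma wedge_scalarr u : scalar (wedge u).
Proof. by move=> c x y; rewrite /wedge !mxE; ring. Qed.

Lemma wedgeC u v : wedge u v = - wedge v u.
Proof. by rewrite /wedge; ring. Qed.

Lemma wedge_plucker u v x y :
  wedge u v * wedge x y = wedge u x * wedge v y + wedge u y * wedge x v.
Proof. by rewrite /wedge; ring. Qed.

(** Multiplicativity of the determinant, for the matrix with rows [h], [k] times the matrix with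
    columns [u], [v]. *)
Lemma dot_wedge h k u v :
  dot h u * dot k v - dot h v * dot k u = wedge h k * wedge u v.
Proof. by rewrite !dotE /wedge; ring. Qed.

Lemma row_mx_unit u v : ((row_mx u v : 'M[R]_2) \in unitmx) = (wedge u v != 0).
Proof.
rewrite unitmxE unitfE; congr (_ != 0).
rewrite (expand_det_row _ 0) big_ord_recl big_ord1 /cofactor !det_mx11 !mxE /=.
do 3![case: splitP => j; rewrite (ord1 j) {j} //= => _].
have -> : lift 0 0 = 1 :> 'I_2 by apply: val_inj.
by rewrite /wedge; ring.
Qed.

(** All of [A] lies strictly on one side of the line through 0 and [c]; there the sign of the wedge
    is a total preorder on directions, so a finite list has an extreme element. Only the sign of [e]
    matters: it fixes the orientation. *)
Lemma angular_extreme (e : R) c A : A != [::] ->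
  (forall a, a \in A -> 0 < e * wedge a c) ->
  exists2 a1, a1 \in A & forall a, a \in A -> 0 <= e * wedge a a1.
Proof.
elim: A => [//|x [_ _ Hx|y A IH _ Hx]].
  exists x; rewrite ?mem_head// => a; rewrite inE => /eqP->.
  by rewrite /wedge; lra.
have {IH}[//||a1 Aa1 Ha1] := IH.
  by move=> a Aa; apply: Hx; rewrite inE Aa orbT.
have [xa1|xa1] := leP 0 (e * wedge x a1).
  exists a1; first by rewrite inE Aa1 orbT.
  by move=> a; rewrite inE => /orP[/eqP->//|]; apply: Ha1.
exists x; first exact: mem_head.
move=> a; rewrite inE => /orP[/eqP->|Aa]; first by rewrite /wedge; lra.
have xc : 0 < e * wedge x c by apply: Hx; rewrite mem_head.
have a1c : 0 < e * wedge a1 c by apply: Hx; rewrite inE Aa1 orbT.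
have ac : 0 < e * wedge a c by apply: Hx; rewrite inE Aa orbT.
have aa1 := Ha1 a Aa.
(* Transitivity through [a1]: after multiplication by the positive [e * wedge a1 c], the Plücker
   relation leaves two products of nonnegative factors. *)
rewrite -(pmulr_lge0 _ a1c) mulrACA wedge_plucker mulrDr.
rewrite (mulrACA e e (wedge a a1)) (mulrACA e e (wedge a c)).
apply: addr_ge0; apply: mulr_ge0; rewrite ?aa1 ?(ltW xc) ?(ltW ac)//.
by rewrite wedgeC mulrN oppr_ge0 ltW.
Qed.

Lemma wedge_separation (e : R) A B : A != [::] -> B != [::] ->
  (forall a b, a \in A -> b \in B -> 0 < e * wedge a b) ->
  exists h, (forall a, a \in A -> 0 < dot h a) /\
            (forall b, b \in B -> dot h b < 0).
Proof.
move=> A0 B0 AB.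
have [a0 Aa0] : exists a, a \in A.
  by case: (A) A0 => // a s _; exists a; rewrite mem_head.
have [b0 Bb0] : exists b, b \in B.
  by case: (B) B0 => // b s _; exists b; rewrite mem_head.
have [a1 Aa1 Ha1] := angular_extreme A0 (fun a Aa => AB a b0 Aa Bb0).
(* Swapping the arguments of the wedge changes its sign, hence [- e] for [B]. *)
have [|b1 Bb1 Hb1] := @angular_extreme (- e) a0 B B0.
  by move=> b Bb; rewrite wedgeC mulrNN; apply: AB.
exists (e *: rot (a1 + b1)).
have hE x : dot (e *: rot (a1 + b1)) x = e * wedge x a1 + e * wedge x b1.
  by rewrite dotE !mxE /= /wedge; ring.
(* Extremality makes one summand only weakly signed; the other pairs an element of [A] with one of
   [B], so it is strict. *)
split=> [a Aa|b Bb]; rewrite hE; first by rewrite ltr_wpDl ?Ha1 ?AB.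
have := Hb1 b Bb; have := AB a1 b Aa1 Bb; rewrite [wedge a1 b]wedgeC; lra.
Qed.

Lemma hull_wedge_separation A B : A != [::] -> B != [::] ->
  (forall u v, hull A u -> hull B v -> wedge u v != 0)
  <->
  (exists h, forall g, g \in A ++ B -> 0 < dot h g) /\
  (exists h, (forall a, a \in A -> 0 < dot h a) /\
             (forall b, b \in B -> dot h b < 0)).
Proof.
move=> A0 B0; split=> [W|[[h hAB] [k [kA kB]]] u v Au Bv]; last first.
  have hu : 0 < dot h u.
    by apply: (hull_gt0 (@dot_scalar h)) Au => g gA; rewrite hAB ?mem_cat ?gA.
  have hv : 0 < dot h v.
    by apply: (hull_gt0 (@dot_scalar h)) Bv => g gB; rewrite hAB ?mem_cat ?gB ?orbT.
  have ku : 0 < dot k u by exact: (hull_gt0 (@dot_scalar k)) Au.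
  (* Negating [k] lets the positivity lemma for hulls apply to [B]. *)
  have kNE x : dot (- k) x = - dot k x by rewrite !dotE !mxE; ring.
  have kv : 0 < dot (- k) v.
    by apply: (hull_gt0 (@dot_scalar (- k))) Bv => g /kB; rewrite kNE oppr_gt0.
  rewrite kNE oppr_gt0 in kv.
  apply/eqP => uv0; have := dot_wedge h k u v; rewrite uv0 mulr0; nra.
have [a0 Aa0] : exists a, a \in A.
  by case: (A) A0 => // a s _; exists a; rewrite mem_head.
have [b0 Bb0] : exists b, b \in B.
  by case: (B) B0 => // b s _; exists b; rewrite mem_head.
pose e := wedge a0 b0.
have eAB a b : a \in A -> b \in B -> 0 < e * wedge a b.
  move=> /hull_mem Aa /hull_mem Bb.
  have /hull_mem Aa0' := Aa0; have /hull_mem Bb0' := Bb0.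
  (* The sign is carried from [(a0, b0)] to [(a, b0)] inside [hull A], then to [(a, b)] inside
     [hull B]; the square of [wedge a b0] is divided out. *)
  have e1 : 0 < e * wedge a b0.
    exact: (hull_same_sign (@wedge_scalarl b0) (fun z Az => W z b0 Az Bb0')).
  have e2 : 0 < wedge a b0 * wedge a b.
    exact: (hull_same_sign (@wedge_scalarr a) (fun z Bz => W a z Aa Bz)).
  have ab0 : 0 < wedge a b0 ^+ 2 by rewrite lt0r sqr_ge0 sqrf_eq0 W.
  by rewrite -(pmulr_rgt0 _ ab0) expr2 mulrACA mulrC [_ * e]mulrC mulrC mulr_gt0.
split; last exact: wedge_separation eAB.
(* A line separating [A] from the reflection of [B] through 0 has [A] and [B] on the same side. *)
have [||h [hA hB]] := @wedge_separation (- e) A (map -%R B) A0.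
- by case: (B) B0.
- move=> a _ Aa /mapP[b Bb ->].
  have -> : wedge a (- b) = - wedge a b by rewrite /wedge !mxE; ring.
  by rewrite mulrNN eAB.
exists h => g; rewrite mem_cat => /orP[/hA//|gB].
have := hB _ (map_f -%R gB); rewrite !dotE !mxE; lra.
Qed.

End Plane.

(** For [p >= 1] both (0, 0) and (1, 0) are valid indices on either domain. Nonemptiness provides
    the extreme elements used in the separation. *)
Lemma G_xi_neq0 (R : realType) U p (f : nat -> nat -> 'cV[R]_2) :
  (1 <= p)%N -> G_xi U p f != [::].
Proof.
move=> p1; rewrite -size_eq0 size_map size_eq0 -has_filter.
apply/hasP; exists (0, 0)%N; last by case: U => /=; rewrite ?p1.
rewrite mem_filter; apply/andP; split; first by case: U.
by apply: allpairs_f; rewrite mem_iota.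
Qed.

Lemma G_eta_neq0 (R : realType) U p (f : nat -> nat -> 'cV[R]_2) :
  (1 <= p)%N -> G_eta U p f != [::].
Proof.
move=> p1; rewrite -size_eq0 size_map size_eq0 -has_filter.
apply/hasP; exists (0, 0)%N; last by case: U => /=; rewrite ?p1.
rewrite mem_filter; apply/andP; split; first by case: U.
by apply: allpairs_f; rewrite mem_iota.
Qed.

Theorem theorem3 (R : realType) (U : dom_shape) (p : nat) (hp : (1 <= p)%N)
    (F : 'cV[R]_2 -> 'cV[R]_2) (hF : polynomial_on U p F)
    (f : nat -> nat -> 'cV[R]_2) (hf : bb_form U p F f) :
  (forall u v : 'cV[R]_2, hull (G_xi U p f) u -> hull (G_eta U p f) v ->
     (row_mx u v : 'M[R]_2) \in unitmx)
  <->
  (exists h : 'cV[R]_2,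
     forall g, g \in G_xi U p f ++ G_eta U p f -> 0 < (h^T *m g) 0 0) /\
  (exists hbar : 'cV[R]_2,
     (forall g, g \in G_xi U p f -> 0 < (hbar^T *m g) 0 0) /\
     (forall g, g \in G_eta U p f -> (hbar^T *m g) 0 0 < 0)).
Proof.
have := hull_wedge_separation (G_xi_neq0 U f hp) (G_eta_neq0 U f hp).
rewrite /dot => <-.
by split=> W u v Au Bv; move: (W u v Au Bv); rewrite row_mx_unit.
Qed.
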